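(* For every integer $m\ge 3$, the halved cube $\Delta_{m+3}$ is a deletion host for $J_m=K_2\vee(K_m\sqcup K_2)$; that is, $E(\Delta_{m+3})\neq\varnothing$, $\Delta_{m+3}$ contains no induced subgraph isomorphic to $J_m$, and for every edge $e$ of $\Delta_{m+3}$ the graph $\Delta_{m+3}-e$ contains an induced subgraph isomorphic to $J_m$.
   Context: The halved cube $\Delta_n$ is the graph whose vertices are the even-cardinality subsets of $[n]=\{1,\dots,n\}$, with $X,Y$ adjacent if and only if $|X\mathbin{\triangle}Y|=2$ (symmetric difference). $\sqcup$ denotes disjoint union of graphs and $\vee$ denotes the join (disjoint union together with all edges between the two graphs). $\Delta_{m+3}-e$ denotes deletion of the edge $e$, keeping all vertices. *)

(* Defs.v *)
From mathcomp Require Import all_boot.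

Set Implicit Arguments.
Unset Strict Implicit.
Unset Printing Implicit Defensive.

Record sgraph := SGraph {
  vertex :> finType;
  adj : rel vertex;
  adj_sym : symmetric adj;
  adj_irr : irreflexive adj
}.

Definition edges (G : sgraph) : {set {set G}} :=
  [set e : {set G} | [exists x : G, exists y : G, adj x y && (e == [set x; y])]].

Definition graph_iso (G H : sgraph) : Prop :=
  exists2 f : G -> H, bijective f & forall x y : G, adj (f x) (f y) = adj x y.

Section Induced.
Variables (G : sgraph) (S : {set G}).
Definition induced_adj : rel {x : G | x \in S} :=
  fun u v => adj (val u) (val v).
Lemma induced_sym : symmetric induced_adj.
Proof. by move=> u v; exact: adj_sym. Qed.
Lemma induced_irr : irreflexive induced_adj.
Proof. by move=> u; exact: adj_irr. Qed.
Definition induced : sgraph := SGraph induced_sym induced_irr.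
End Induced.

Definition contains_induced (G H : sgraph) : Prop :=
  exists S : {set G}, graph_iso (induced S) H.

Section DeleteEdge.
Variables (G : sgraph) (e : {set G}).
Definition del_edge_adj : rel G := fun x y => adj x y && ([set x; y] != e).
Lemma del_edge_sym : symmetric del_edge_adj.
Proof. by move=> x y; rewrite /del_edge_adj adj_sym setUC. Qed.
Lemma del_edge_irr : irreflexive del_edge_adj.
Proof. by move=> x; rewrite /del_edge_adj adj_irr. Qed.
Definition del_edge : sgraph := SGraph del_edge_sym del_edge_irr.
End DeleteEdge.

Section Complete.
Variable n : nat.
Definition complete_adj : rel 'I_n := fun i j => i != j.
Lemma complete_sym : symmetric complete_adj.
Proof. by move=> i j; rewrite /complete_adj eq_sym. Qed.
Lemma complete_irr : irreflexive complete_adj.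
Proof. by move=> i; rewrite /complete_adj eqxx. Qed.
Definition complete : sgraph := SGraph complete_sym complete_irr.
End Complete.

Section DisjointUnionJoin.
Variables G H : sgraph.

Definition disjoint_union_adj : rel (G + H)%type := fun u v =>
  match u, v with
  | inl x, inl y => adj x y
  | inr x, inr y => adj x y
  | _, _ => false
  end.
Lemma disjoint_union_sym : symmetric disjoint_union_adj.
Proof. by move=> [x|x] [y|y] //=; exact: adj_sym. Qed.
Lemma disjoint_union_irr : irreflexive disjoint_union_adj.
Proof. by move=> [x|x] /=; exact: adj_irr. Qed.
Definition disjoint_union : sgraph :=
  SGraph disjoint_union_sym disjoint_union_irr.

Definition join_adj : rel (G + H)%type := fun u v =>
  match u, v with
  | inl x, inl y => adj x y
  | inr x, inr y => adj x y
  | _, _ => true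
  end.
Lemma join_sym : symmetric join_adj.
Proof. by move=> [x|x] [y|y] //=; exact: adj_sym. Qed.
Lemma join_irr : irreflexive join_adj.
Proof. by move=> [x|x] /=; exact: adj_irr. Qed.
Definition join : sgraph := SGraph join_sym join_irr.
End DisjointUnionJoin.

Definition symdiff (T : finType) (X Y : {set T}) : {set T} :=
  (X :\: Y) :|: (Y :\: X).

(* The ground set [n] is represented by 'I_n = {0, ..., n-1}. *)
Section HalvedCube.
Variable n : nat.
Definition even_set := {X : {set 'I_n} | ~~ odd #|X|}.
Definition halved_cube_adj : rel even_set :=
  fun X Y => #|symdiff (val X) (val Y)| == 2.
Lemma halved_cube_sym : symmetric halved_cube_adj.
Proof. by move=> X Y; rewrite /halved_cube_adj /symdiff setUC. Qed.
Lemma halved_cube_irr : irreflexive halved_cube_adj.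
Proof. by move=> X; rewrite /halved_cube_adj /symdiff setDv setU0 cards0. Qed.
Definition halved_cube : sgraph := SGraph halved_cube_sym halved_cube_irr.
End HalvedCube.

Definition J (m : nat) : sgraph :=
  join (complete 2) (disjoint_union (complete m) (complete 2)).

Definition deletion_host (G H : sgraph) : Prop :=
  [/\ edges G <> set0,
      ~ contains_induced G H
    & forall e : {set G}, e \in edges G -> contains_induced (del_edge e) H].

(* Main.v *)
(** In the halved cube, the common neighbours of [U] and [V = U △ {p,q}] are the
    sets [U △ {x,i}] with [x] in [{p,q}] and [i] outside it, and they induce a
    rook's graph with two rows ([x]) and [m + 1] columns ([i]).  A clique
    [K_m] with [m >= 3] lies in one row, so a [K_2] nonadjacent to it lies in the
    other row and in two further columns: one column too many.  Once the edge
    between the two cells of a column [r] is deleted, the [K_2] may use column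
    [r] together with the only column [s] avoided by the clique. *)

Require Import Defs.
From mathcomp Require Import all_boot.

Set Implicit Arguments.
Unset Strict Implicit.
Unset Printing Implicit Defensive.

(** * Induced copies as embeddings, and twins in [J m] *)

Lemma contains_inducedP (G H : sgraph) :
  contains_induced G H <->
  exists2 f : H -> G, injective f & forall x y, adj (f x) (f y) = adj x y.
Proof.
split=> [[S [g [h gK hK] gadj]]|[f finj fadj]].
  exists (fun x => val (h x)); first exact: inj_comp val_inj (can_inj hK).
  by move=> x y; rewrite -[in RHS](hK x) -[in RHS](hK y) gadj.
have fS (x : H) : f x \in f @: [set: H] by rewrite imset_f.
have bij : bijective (fun x => exist _ (f x) (fS x) : induced (f @: [set: H])).
  apply: inj_card_bij => [x y [/finj]//|].
  by rewrite card_sig -[leqRHS]cardsT -(card_imset _ finj).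
case: bij => g fK gK; exists (f @: [set: H]), g; first exact: Bijective gK fK.
by move=> x y; rewrite -[in RHS](gK x) -[in RHS](gK y) -fadj.
Qed.

Lemma ord_neq m (hm : 1 < m) (k : 'I_m) : exists l : 'I_m, l != k.
Proof.
have /card_gt0P [l] : 0 < #|[set~ k]| by rewrite cardsC1 card_ord -subn1 subn_gt0.
by rewrite !inE; exists l.
Qed.

(** Twins are nonadjacent, so distinct ones would lie one in the [K_m] and one in the lower [K_2]; a
    second vertex of the clique of [x] is adjacent to [x] alone. It follows that a map from [J m]
    that preserves and reflects adjacency is injective, which [contains_J] exploits. *)
Lemma J_twin_free m (hm : 1 < m) (x y : J m) :
  (forall z : J m, adj x z = adj y z) -> x = y.
Proof.
move=> tw; apply/eqP; apply/negPn/negP => xy.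
have := tw y; rewrite adj_irr => nxy.
case: x y tw xy nxy => [k|[k|k]] [l|[l|l]] //= tw xy /= nxy.
- by move: nxy xy; rewrite /= /complete_adj => /negbFE/eqP ->; rewrite eqxx.
- by move: nxy xy; rewrite /= /complete_adj => /negbFE/eqP ->; rewrite eqxx.
- have [j jk] := ord_neq hm k; have := tw (inr (inl j)).
  by rewrite /= /complete_adj eq_sym jk.
- have [j jk] := @ord_neq 2 isT k; have := tw (inr (inr j)).
  by rewrite /= /complete_adj eq_sym jk.
- by move: nxy xy; rewrite /= /complete_adj => /negbFE/eqP ->; rewrite eqxx.
Qed.

Lemma contains_J m (hm : 1 < m) (G : sgraph) (f : J m -> G) :
  (forall x y, adj (f x) (f y) = adj x y) -> contains_induced G (J m).
Proof.
move=> fadj; apply/contains_inducedP; exists f => // x y fxy.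
by apply: J_twin_free => // z; rewrite -!fadj fxy.
Qed.

(** * Symmetric differences, and pairs as cells of a rook's graph *)

Section SymDiff.
Variable T : finType.
Implicit Types (A B C : {set T}) (x y i j p q : T).

Lemma in_symdiff A B x : (x \in symdiff A B) = (x \in A) (+) (x \in B).
Proof. by rewrite !inE; do 2!case: (_ \in _). Qed.

Lemma symdiffA A B C : symdiff A (symdiff B C) = symdiff (symdiff A B) C.
Proof. by apply/setP=> x; rewrite !in_symdiff addbA. Qed.

Lemma symdiffC A B : symdiff A B = symdiff B A.
Proof. by apply/setP=> x; rewrite !in_symdiff addbC. Qed.

Lemma symdiffK A : cancel (symdiff A) (symdiff A).
Proof. by move=> B; apply/setP=> x; rewrite !in_symdiff addKb. Qed.

Lemma symdiffv A : symdiff A A = set0.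
Proof. by rewrite /symdiff setDv setU0. Qed.

Lemma sym0diff A : symdiff set0 A = A.
Proof. by apply/setP=> x; rewrite in_symdiff inE. Qed.

Lemma symdiff_translate A B C : symdiff (symdiff A B) (symdiff A C) = symdiff B C.
Proof. by apply/setP=> x; rewrite !in_symdiff; do 3!case: (_ \in _). Qed.

Lemma odd_symdiff A B : odd #|symdiff A B| = odd #|A| (+) odd #|B|.
Proof.
rewrite /symdiff cardsU -(cardsID B A) -(cardsID A B) [B :&: A]setIC.
have -> : (A :\: B) :&: (B :\: A) = set0.
  by apply/setP=> x; rewrite !inE; do 2!case: (_ \in _).
by rewrite cards0 subn0 !oddD; do 3!case: (odd _).
Qed.

Lemma eq_set2 x y i j : ([set x; y] == [set i; j]) =
  ((x == i) && (y == j)) || ((x == j) && (y == i)).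
Proof.
apply/eqP/idP=> [e|/orP[]/andP[/eqP-> /eqP->]//]; last exact: setUC.
have ixy : i \in [set x; y] by rewrite e set21.
have jxy : j \in [set x; y] by rewrite e set22.
have: y \in [set i; j] by rewrite -e set22.
have: x \in [set i; j] by rewrite -e set21.
move=> /set2P[xE|xE] /set2P[yE|yE]; move: ixy jxy; rewrite xE yE ?eqxx ?orbT // setUid.
  by move=> _ /set1P->; rewrite eqxx.
by move=> /set1P-> _; rewrite eqxx.
Qed.

(** This is rook adjacency, with [[set x; i]] the cell in row [x] and column [i]. The hypotheses
    keep rows apart from columns, so cells that differ in both coordinates are disjoint pairs, with
    a symmetric difference of size 4. *)
Lemma card_symdiff_set2 x y i j :
  x != i -> x != j -> y != i -> y != j ->
  (#|symdiff [set x; i] [set y; j]| == 2) = (x == y) (+) (i == j).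
Proof.
move=> xi xj yi yj.
case: (eqVneq x y) => [<-|xy]; case: (eqVneq i j) => [<-|ij] /=.
- by rewrite symdiffv cards0.
- suff -> : symdiff [set x; i] [set x; j] = [set i; j] by rewrite cards2 ij.
  apply/setP=> z; rewrite in_symdiff !inE; case: (eqVneq z x) => [->|//=].
    by rewrite (negbTE xi) (negbTE xj).
  by move=> _; case: (eqVneq z i) => [->|//]; rewrite (negbTE ij).
- suff -> : symdiff [set x; i] [set y; i] = [set x; y] by rewrite cards2 xy.
  apply/setP=> z; rewrite in_symdiff !inE; case: (eqVneq z i) => [->|//=].
    by rewrite ![i == _]eq_sym !orbT (negbTE xi) (negbTE yi).
  by move=> _; rewrite !orbF; case: (eqVneq z x) => [->|//]; rewrite (negbTE xy).
- suff -> : symdiff [set x; i] [set y; j] = [set x; i] :|: [set y; j].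
    rewrite cardsU !cards2 xi yj; suff -> : [set x; i] :&: [set y; j] = set0.
      by rewrite cards0.
    apply/setP=> z; rewrite !inE; apply/negP=> /andP[/orP[]/eqP-> /orP[]].
    + by rewrite (negbTE xy).
    + by rewrite (negbTE xj).
    + by rewrite eq_sym (negbTE yi).
    + by rewrite (negbTE ij).
  apply/setP=> z; rewrite in_symdiff !inE.
  case: (eqVneq z x) => [->|_] /=; first by rewrite (negbTE xy) (negbTE xj).
  case: (eqVneq z i) => [->|//] /=.
  by rewrite eq_sym (negbTE yi) (negbTE ij).
Qed.

(** A pair inside [[set p; q]] is equal to it and a pair outside is disjoint from it, giving
    differences of size 0 and 4. Only a pair meeting it in one point remains. *)
Lemma common_nbr p q A : p != q -> #|A| == 2 -> #|symdiff [set p; q] A| == 2 ->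
  exists x i, [/\ A = [set x; i], x \in [set p; q] & i \notin [set p; q]].
Proof.
move=> pq /cards2P [x [i [xi ->]]].
have [xP|xP] := boolP (x \in [set p; q]); have [iP|iP] := boolP (i \in [set p; q]).
- suff -> : [set x; i] = [set p; q] by rewrite symdiffv cards0.
  by apply/eqP; rewrite eqEcard !cards2 pq xi andbT subUset !sub1set xP.
- by exists x, i.
- by exists i, x; rewrite setUC.
- move: xP iP; rewrite !inE !negb_or => /andP[xp xq] /andP[ip iq].
  rewrite card_symdiff_set2 //; last by rewrite eq_sym.
  by rewrite ![_ == x]eq_sym ![_ == i]eq_sym (negbTE xp) (negbTE iq).
Qed.
End SymDiff.

(** * Rook's graphs with two rows, and the absence of [J m] *)

Lemma rook_K_row m (hm : 2 < m) (T : finType) (p q : T) (row col : 'I_m -> T) :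
  (forall k, row k \in [set p; q]) ->
  (forall k l, (k != l) = (row k == row l) (+) (col k == col l)) ->
  forall k l, row k = row l.
Proof.
move=> rowP adjP k l; apply/eqP/negPn/negP => kl.
have k'l : k != l by apply: contraNneq kl => ->.
(* Being adjacent in different rows, [k] and [l] share a column. A third clique vertex [j] lies in
   the row of exactly one of them: adjacency to that one keeps [j] off the common column, adjacency
   to the other puts it there. *)
have /card_gt0P [j] : 0 < #|~: [set k; l]|.
  by rewrite cardsCs setCK cards2 k'l card_ord subn_gt0.
rewrite !inE negb_or => /andP[jk jl].
have := adjP k l; rewrite k'l (negbTE kl) => /esym /= /eqP ckl.
have := adjP j k; have := adjP j l; rewrite jk jl ckl.
have: (row j == row k) (+) (row j == row l).
  move: (rowP j) (rowP k) (rowP l) kl => /set2P[]-> /set2P[]-> /set2P[]->;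
  by rewrite ?eqxx // eq_sym => /negbTE->.
by do 3!case: (_ == _).
Qed.

(** The [K_m] fills cells of one row. A vertex of the [K_2] in that row, being nonadjacent to the
    clique, would share its column with every clique vertex, collapsing the clique; so the [K_2]
    lies in the other row. Within a row the column determines the vertex, and across rows an equal
    column would create an edge. *)
Lemma rook_J_col_inj m (hm : 2 < m) (T : finType) (p q : T)
    (row col : 'I_m + 'I_2 -> T) :
  (forall z, row z \in [set p; q]) ->
  (forall z w, row z = row w -> col z = col w -> z = w) ->
  (forall z w : disjoint_union (complete m) (complete 2),
     adj z w = (row z == row w) (+) (col z == col w)) ->
  injective col.
Proof.
move=> rowP rcinj adjP.
have rowK := rook_K_row hm (fun k => rowP (inl k)) (fun k l => adjP (inl k) (inl l)).
have rowK2 k l : row (inl k) != row (inr l).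
  apply/eqP=> kl; have [j jk] := ord_neq (ltnW hm) k.
  have ck i : col (inl i) = col (inr l).
    have := adjP (inl i) (inr l).
    by rewrite /= (rowK i k) kl eqxx => /esym/negbFE/eqP.
  have [/eqP] : inl j = inl k :> 'I_m + 'I_2 by apply: rcinj; rewrite ?ck.
  by rewrite (negbTE jk).
have row2 k l : row (inr k) = row (inr l).
  have i := Ordinal (ltnW (ltnW hm)).
  move: (rowK2 i k) (rowK2 i l).
  move: (rowP (inl i)) (rowP (inr k)) (rowP (inr l)).
  by move=> /set2P[]-> /set2P[]-> /set2P[]->; rewrite ?eqxx.
move=> [k|k] [l|l] czw; try by apply: rcinj.
  by have := adjP (inl k) (inr l); rewrite czw eqxx (negbTE (rowK2 k l)).
by have := adjP (inr k) (inl l); rewrite czw eqxx eq_sym (negbTE (rowK2 l k)).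
Qed.

Lemma halved_cube_J_free m (hm : 2 < m) : ~ contains_induced (halved_cube m.+3) (J m).
Proof.
move=> /contains_inducedP [f finj fadj].
(* The two vertices joined to everything go to [U] and [U △ {p,q}]; all the other images are common
   neighbours of these, hence cells. *)
pose U := val (f (inl ord0)).
have fadjE x y : (#|symdiff (val (f x)) (val (f y))| == 2) = adj x y by rewrite -fadj.
have := fadjE (inl ord0) (inl ord_max) => /cards2P [p [q [pq UV]]].
have /fin_all_exists [row /fin_all_exists [col rcP]] : forall z : 'I_m + 'I_2,
    exists x i, [/\ symdiff U (val (f (inr z))) = [set x; i],
                    x \in [set p; q] & i \notin [set p; q]].
  move=> z; apply: common_nbr => //; first by rewrite fadjE.
  by rewrite -UV symdiff_translate fadjE.
have rcV z : val (f (inr z)) = symdiff U [set row z; col z].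
  by case: (rcP z) => <- _ _; rewrite symdiffK.
have rowP z : row z \in [set p; q] by case: (rcP z).
have colP z : col z \notin [set p; q] by case: (rcP z).
have rc z w : row z != col w by apply: contraNneq (colP w) => <-.
have colinj : injective col.
  apply: (rook_J_col_inj hm rowP) => [z w rzw czw|z w].
    have [//] : inr z = inr w :> J m.
    by apply/finj/val_inj; rewrite !rcV rzw czw.
  rewrite -card_symdiff_set2 // -(symdiff_translate U) -!rcV.
  by rewrite (fadjE (inr z) (inr w)).
(* There are [m + 2] distinct columns, but only [m + 1] points outside [[set p; q]]. *)
have /subset_leq_card : col @: setT \subset ~: [set p; q].
  by apply/subsetP=> _ /imsetP[z _ ->]; rewrite inE.
rewrite card_imset // cardsT card_sum !card_ord cardsCs setCK card_ord cards2 pq.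
by rewrite subn2 addn2 ltnn.
Qed.

(** * A copy of [J m] after the deletion of an edge *)

Section DeletedEdge.
Variables (m : nat) (T : finType) (p q r s : T) (c : 'I_m -> T).
Hypotheses (pq : p != q) (r_pq : r \notin [set p; q]) (s_pq : s \notin [set p; q]).
Hypotheses (rs : r != s) (cinj : injective c) (c_s : forall k, c k != s).
Hypothesis c_pq : forall k, c k \notin [set p; q].

(** The copy up to translation by [U]: the clique in row [p], the lower [K_2] in row [q] and columns
    [r] and [s]. The clique may use column [r], where the edge is deleted, but not [s]. *)
Definition J_cell (x : J m) : {set T} :=
  match x with
  | inl k => if k == ord0 then set0 else [set p; q]
  | inr (inl k) => [set p; c k]
  | inr (inr k) => [set q; if k == ord0 then r else s]
  end.

Lemma J_cell_adj (x y : J m) :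
  (#|symdiff (J_cell x) (J_cell y)| == 2) &&
    ([set J_cell x; J_cell y] != [set [set p; r]; [set q; r]]) = adj x y.
Proof.
have sep i : i \notin [set p; q] -> (p != i) * (q != i).
  by rewrite !inE negb_or ![i == _]eq_sym => /andP[].
pose c2 (k : 'I_2) := if k == ord0 then r else s.
have c2_pq k : c2 k \notin [set p; q] by rewrite /c2; case: ifP.
have sC k := sep _ (c_pq k); have s2 k := sep _ (c2_pq k).
have sr := sep _ r_pq.
have c2inj : injective c2.
  move=> [[|[|//]] Hi] [[|[|//]] Hj]; rewrite /c2 -!val_eqE /= => e;
    by [apply: val_inj | move: rs; rewrite e eqxx].
(* Besides adjacency to every cell, this records that an apex is not itself a cell, so that no edge
   at an apex is the deleted one. *)
have apexE k i a : a \in [set p; q] -> i \notin [set p; q] ->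
    (#|symdiff (J_cell (inl k)) [set a; i]| == 2) && (J_cell (inl k) != [set a; i]).
  move=> apq ipq; have [pi qi] := sep _ ipq.
  have ai : a != i by case/set2P: apq => ->.
  rewrite /J_cell; case: ifP => _.
    rewrite sym0diff cards2 ai /=; apply/eqP=> /setP/(_ a).
    by rewrite !inE eqxx.
  apply/andP; split; last first.
    by apply: contraNneq ipq => ->; rewrite set22.
  case/set2P: apq => ->; last rewrite [[set p; q]]setUC;
    by rewrite card_symdiff_set2 ?eqxx // 1?eq_sym //= (negbTE pi, negbTE qi).
have apexN k A : [set J_cell (inl k); A] != [set [set p; r]; [set q; r]].
  have /andP[_ /negbTE h1] := apexE k r p (set21 p q) r_pq.
  have /andP[_ /negbTE h2] := apexE k r q (set22 p q) r_pq.
  by rewrite eq_set2 h1 h2.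
have qp : q != p by rewrite eq_sym.
pose part (z : J m) := match z with inl _ => 0 | inr (inl _) => 1 | inr (inr _) => 2 end.
(* Both sides are symmetric, which leaves six of the nine pairs of parts. *)
wlog: x y / part x <= part y.
  by move=> W; case: (leqP (part x) (part y)) => [/W//|/ltnW/W];
    rewrite symdiffC setUC adj_sym.
case: x y => [k|[k|k]] [l|[l|l]] // _.
- rewrite apexN andbT /=; case: k l => [[|[|//]] Hk] [[|[|//]] Hl];
  rewrite /complete_adj -!val_eqE /= ?symdiffv ?cards0 ?sym0diff ?cards2 ?pq //.
  by rewrite symdiffC sym0diff cards2 pq.
- by rewrite apexN andbT; case/andP: (apexE k (c l) p (set21 p q) (c_pq l)).
- by rewrite apexN andbT; case/andP: (apexE k (c2 l) q (set22 p q) (c2_pq l)).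
- rewrite /= card_symdiff_set2 ?sC // eqxx (inj_eq cinj) eq_set2.
  by rewrite ![_ == [set q; r]]eq_set2 (negbTE pq) (negbTE sr.1) /= !andbF andbT.
- rewrite /= -/(c2 l) card_symdiff_set2 ?sC ?s2 // (negbTE pq) /=.
  (* Cells in different rows are adjacent only in a common column. It is not [s], so it is [r], and
     the edge is the deleted one. *)
  apply/negP=> /andP[/eqP e]; rewrite -e; move: (c_s k); rewrite e /c2.
  by case: ifP => _; rewrite eqxx.
- rewrite /= -/(c2 k) -/(c2 l) card_symdiff_set2 ?s2 // eqxx (inj_eq c2inj) eq_set2.
  by rewrite ![_ == [set p; r]]eq_set2 (negbTE qp) (negbTE sr.2) /= !andbF andbT.
Qed.

Lemma J_cell_even x : ~~ odd #|J_cell x|.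
Proof.
have e i : i \notin [set p; q] -> ~~ odd #|[set p; i]| && ~~ odd #|[set q; i]|.
  by rewrite !inE negb_or ![i == _]eq_sym !cards2 => /andP[-> ->].
case: x => [k|[k|k]] /=.
- by case: ifP => _; rewrite ?cards0 // cards2 pq.
- by case/andP: (e _ (c_pq k)).
- by case: ifP => _; [case/andP: (e _ r_pq) | case/andP: (e _ s_pq)].
Qed.

End DeletedEdge.

Lemma del_edge_halved_cube_J m (hm : 2 < m) (e : {set halved_cube m.+3}) :
  e \in edges (halved_cube m.+3) -> contains_induced (del_edge e) (J m).
Proof.
rewrite inE => /existsP[X /existsP[Y /andP[/cards2P[p [q [pq XY]]] /eqP->]]].
have /card_gt0P [r r_pq] : 0 < #|~: [set p; q]|.
  by rewrite cardsCs setCK card_ord cards2 pq subn2.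
rewrite inE in r_pq.
have cpqr : #|[set p; q; r]| = 3 by rewrite setUC cardsU1 r_pq cards2 pq.
have /card_gt0P [s] : 0 < #|~: [set p; q; r]|.
  by rewrite cardsCs setCK card_ord cpqr subn_gt0 !ltnS (ltnW (ltnW hm)).
rewrite inE in_setU in_set1 negb_or eq_sym => /andP[s_pq rs].
(* The clique takes all [m] columns other than [s], including [r]. *)
pose D := ~: [set p; q; s].
have cD : #|D| = m.
  by rewrite cardsCs setCK card_ord setUC cardsU1 s_pq cards2 pq subSS subSS subSS subn0.
pose c (k : 'I_m) := enum_val (cast_ord (esym cD) k).
have cP k : (c k \notin [set p; q]) && (c k != s).
  by have := enum_valP (cast_ord (esym cD) k); rewrite inE in_setU in_set1 negb_or.
have cinj : injective c by move=> k l /enum_val_inj/cast_ord_inj.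
have c_pq k : c k \notin [set p; q] by case/andP: (cP k).
have c_s k : c k != s by case/andP: (cP k).
(* This choice makes the ends [X] and [Y] of the deleted edge the two cells of column [r], not the
   apexes. *)
pose U := symdiff (val X) [set p; r].
have UX : val X = symdiff U [set p; r] by rewrite symdiffC symdiffA symdiffC symdiffK.
have UY : val Y = symdiff U [set q; r].
  have -> : [set q; r] = symdiff [set p; r] [set p; q].
    apply/setP=> z; rewrite in_symdiff !inE; move: r_pq pq.
    rewrite !inE; case: (eqVneq z p) => [->|_]; rewrite ?orbF //=.
      by rewrite negb_or ![p == _]eq_sym => /andP[/negbTE-> _] /negbTE; rewrite eq_sym => ->.
    by case: (eqVneq z r) => [->|_]; rewrite ?orbF // orbT negb_or => /andP[_ /negbTE->].
  by rewrite symdiffA -UX -XY symdiffK.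
have evenU x : ~~ odd #|symdiff U (J_cell p q r s c x)|.
  rewrite odd_symdiff (negbTE (J_cell_even pq r_pq s_pq c_pq x)) addbF.
  rewrite odd_symdiff (negbTE (valP X)) cards2.
  by move: r_pq; rewrite !inE negb_or eq_sym => /andP[-> _].
pose f x : del_edge [set X; Y] :=
  exist (fun A : {set 'I_m.+3} => ~~ odd #|A|) _ (evenU x).
apply: (contains_J (ltnW hm) (f := f)) => x y.
rewrite -(J_cell_adj pq r_pq s_pq rs cinj c_s c_pq) /= /del_edge_adj /=.
congr (_ && ~~ _); first by rewrite /halved_cube_adj /= symdiff_translate.
(* Translation by [U] is injective, so whether an edge is the deleted one can be tested on cells. *)
have fE z A (Z : halved_cube m.+3) : val Z = symdiff U A ->
    (f z == Z) = (J_cell p q r s c z == A).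
  by move=> ZA; rewrite -(inj_eq val_inj) ZA (inj_eq (can_inj (symdiffK U))).
by rewrite !eq_set2 !(fE _ _ _ UX) !(fE _ _ _ UY).
Qed.

Theorem proposition6p2 (m : nat) (hm : 3 <= m) :
  deletion_host (halved_cube (m + 3)) (J m).
Proof.
rewrite addn3; split; [|exact: halved_cube_J_free|exact: del_edge_halved_cube_J].
have even0 : ~~ odd #|set0 : {set 'I_m.+3}| by rewrite cards0.
have even2 : ~~ odd #|[set ord0; ord_max] : {set 'I_m.+3}| by rewrite cards2.
pose X : halved_cube m.+3 := exist (fun A : {set 'I_m.+3} => ~~ odd #|A|) _ even0.
pose Y : halved_cube m.+3 := exist (fun A : {set 'I_m.+3} => ~~ odd #|A|) _ even2.
apply/eqP/set0Pn; exists [set X; Y]; rewrite inE.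
apply/existsP; exists X; apply/existsP; exists Y.
by rewrite eqxx andbT /= /halved_cube_adj /= sym0diff cards2.
Qed.
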